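(* Let $(a_n)_{n\ge1}$ be a sequence of complex numbers and let $b>1$ be an integer. Then $$\Big(\sum_{k=1}^\infty \frac{1}{b^k}\Big|\sum_{j=1}^{b^k} a_j\Big|^2\Big)^{1/2}\le \frac{\sqrt b+1}{\sqrt{b-1}}\,\Big(\sum_{n=1}^\infty |a_n|^2\Big)^{1/2}.$$ Moreover, for each integer $b>1$ the constant $\frac{\sqrt b+1}{\sqrt{b-1}}$ is sharp, i.e. it cannot be replaced by any smaller constant (depending on $b$) for which the inequality holds for all sequences; and, for $(a_n)_{n\ge1}$ in $\ell^2$, the inequality is strict unless $(a_n)_{n\ge1}$ is the null sequence ($a_n=0$ for all $n$).
   Context: $\ell^2$ is the space of complex sequences $(a_n)_{n\ge1}$ with $\sum_{n=1}^\infty|a_n|^2<\infty$. The inequality is understood in $[0,+\infty]$, and is trivially true when the right-hand side is $+\infty$. *)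

(* Defs.v *)
From mathcomp Require Export all_boot all_order all_algebra.
From mathcomp Require Export all_classical all_reals all_analysis.
From mathcomp Require Export complex.
Export Order.TTheory GRing.Theory Num.Theory.
Export numFieldNormedType.Exports.

Set Implicit Arguments.
Unset Strict Implicit.
Unset Printing Implicit Defensive.

Local Open Scope ring_scope.
Local Open Scope complex_scope.

(* A complex sequence (a_n)_(n >= 1) is encoded as a : nat -> R[i]; the value
   a 0 is irrelevant and never used. Series of nonnegative terms are taken
   in \bar R, so that both sides of the inequality live in [0, +oo], and
   ComplexField.Normc.normc is the R-valued modulus. *)

Definition sum_sq (R : realType) (a : nat -> R[i]) : \bar R :=
  (\sum_(1 <= n <oo) (ComplexField.Normc.normc (a n) ^+ 2)%:E)%E.

Definition in_l2 (R : realType) (a : nat -> R[i]) : Prop :=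
  (sum_sq a < +oo)%E.

Definition l2norm (R : realType) (a : nat -> R[i]) : \bar R :=
  (sum_sq a `^ 2^-1)%E.

Definition block_norm (R : realType) (b : nat) (a : nat -> R[i]) : \bar R :=
  ((\sum_(1 <= k <oo)
      ((b%:R ^+ k)^-1 *
       ComplexField.Normc.normc (\sum_(1 <= j < (b ^ k).+1) a j) ^+ 2)%:E)
   `^ 2^-1)%E.

Definition sharp_const (R : realType) (b : nat) : R :=
  (Num.sqrt b%:R + 1) / Num.sqrt (b%:R - 1).

(* Main.v *)
Require Import Defs.
From mathcomp Require Import ring lra zify.

Set Implicit Arguments.
Unset Strict Implicit.
Unset Printing Implicit Defensive.

Local Open Scope ring_scope.
Local Open Scope complex_scope.

(** Put r = sqrt b, S_n = a_1 + ... + a_n, x_k = |S_(b^k)|^2 / b^k and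
    E(n) = |a_1|^2 + ... + |a_n|^2; the square of the constant is
    (r + 1) / (r - 1).

    The inequality. Passing from S_(b^k) to S_(b^(k+1)) adds the block
    b^k < j <= b^(k+1), whose b^k (r^2 - 1) terms are controlled by
    Cauchy-Schwarz. Together with the weighted inequality
    (u + t)^2 <= r u^2 + r/(r-1) t^2 this gives the one-step estimate
<<
      r x_(k+1) <= x_k + (r + 1) (E(b^(k+1)) - E(b^k)).
>>
    It says exactly that the quantity
<<
      gap n = (r + 1) E(b^n) - (r - 1) (x_1 + ... + x_n) - x_n
>>
    is nondecreasing in n ([gap_homo]). Since gap 0 = r |a_1|^2 >= 0, the gap
    is nonnegative, and n -> oo gives (r - 1) sum x_k <= (r + 1) sum |a_n|^2.

    Strictness. If E(b^n) = 0 but E(b^(n+1)) > 0, then S_(b^n) = 0, and the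
    one-step estimate is strict because the weighted inequality is wasteful
    for u = 0. So the gap is positive as soon as one of the first b^n terms is
    nonzero ([gap_gt0]); being nondecreasing, it bounds from below the
    difference between the two sides in the limit.

    Sharpness. Equality in every step forces a to be constant on blocks with
    |S_(b^k)| proportional to r^k; normalize by S_1 = 1, so that x_k = 1 for
    all k. Such a sequence is not in l^2, but when it
    is cut after N blocks, the sum of the x_k is at least N, while each block
    contributes (r - 1) / (r + 1) to the sum of the |a_n|^2, which is therefore
    1 + N (r - 1) / (r + 1). The ratio tends to (r + 1) / (r - 1). *)

Import ComplexField.Normc.

(** * Sums of moduli *)

(** Cauchy-Schwarz against the constant 1. For c the number of terms and S their
    sum, it is the positivity of the variance: the sum of the (c x_i - S)^2. *)
Lemma sqr_sum_le (R : realFieldType) (I : Type) (s : seq I) (x : I -> R) :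
  (\sum_(i <- s) x i) ^+ 2 <= (size s)%:R * \sum_(i <- s) x i ^+ 2.
Proof.
case: s => [|i0 s']; first by rewrite !big_nil expr0n mulr0.
set s := i0 :: s'; set c : R := (size s)%:R; set S := \sum_(i <- s) x i.
have c0 : 0 < c by rewrite ltr0n.
have: 0 <= \sum_(i <- s) (c * x i - S) ^+ 2.
  by apply: sumr_ge0 => i _; apply: sqr_ge0.
have -> : \sum_(i <- s) (c * x i - S) ^+ 2 =
          c * (c * (\sum_(i <- s) x i ^+ 2) - S ^+ 2).
  rewrite (eq_bigr (fun i => c ^+ 2 * x i ^+ 2 - 2 * c * S * x i + S ^+ 2));
    last by move=> i _; ring.
  rewrite big_split /= sumrB -!mulr_sumr -/S big_const_seq count_predT iter_addr_0.
  by rewrite -[S *+ _]mulr_natr -/c; ring.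
by rewrite pmulr_rge0 // subr_ge0.
Qed.

Lemma normc_ge0 (R : rcfType) (z : R[i]) : 0 <= normc z.
Proof. by case: z => x y; apply: sqrtr_ge0. Qed.

Lemma normc_real (R : rcfType) (x : R) : normc x%:C = `|x|.
Proof. by rewrite /normc /= expr0n addr0 sqrtr_sqr. Qed.

Lemma normc_gt0 (R : rcfType) (z : R[i]) : z != 0 -> 0 < normc z.
Proof.
move=> z0; rewrite lt0r normc_ge0 andbT.
by apply: contra z0 => /eqP /eq0_normc ->.
Qed.

Lemma le_normc_sum (R : rcfType) (I : Type) (s : seq I) (a : I -> R[i]) :
  normc (\sum_(i <- s) a i) <= \sum_(i <- s) normc (a i).
Proof.
elim: s => [|i s IH]; first by rewrite !big_nil normc0.
by rewrite !big_cons (le_trans (le_normcD _ _)) // lerD2l.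
Qed.

Lemma sqr_normc_sum_le (R : rcfType) (a : nat -> R[i]) (m n : nat) :
  normc (\sum_(m <= j < n) a j) ^+ 2 <=
  (n - m)%:R * \sum_(m <= j < n) normc (a j) ^+ 2.
Proof.
have := sqr_sum_le (index_iota m n) (fun j => normc (a j)).
rewrite size_iota; apply: le_trans.
rewrite lerXn2r ?nnegrE ?normc_ge0 ?sumr_ge0 ?le_normc_sum // => i _.
exact: normc_ge0.
Qed.

(** The difference of the two sides is ((r - 1) u - t)^2. In the one-step
    estimate r is sqrt b: after division by b^(n+1) = r^2 b^n the old block term
    then keeps the factor 1/r, and r x_(n+1) against x_n telescopes. *)
Lemma weighted_sqrD_le (R : realFieldType) (r u t : R) : 1 < r ->
  (r - 1) * (u + t) ^+ 2 <= r * ((r - 1) * u ^+ 2 + t ^+ 2).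
Proof.
move=> r1; rewrite -subr_ge0.
rewrite (_ : _ - _ = ((r - 1) * u - t) ^+ 2) ?sqr_ge0 //; ring.
Qed.

(** * The gap and its monotonicity *)

Definition energy (R : realType) (a : nat -> R[i]) (n : nat) : R :=
  \sum_(1 <= j < n.+1) normc (a j) ^+ 2.

Definition block_term (R : realType) (b : nat) (a : nat -> R[i]) (k : nat) : R :=
  (b%:R ^+ k)^-1 * normc (\sum_(1 <= j < (b ^ k).+1) a j) ^+ 2.

(** The slack left in the inequality at rank n. The term - block_term n is what
    makes it monotone: the estimate for the next block term involves the
    current one. *)
Definition gap (R : realType) (b : nat) (a : nat -> R[i]) (n : nat) : R :=
  (Num.sqrt b%:R + 1) * energy a (b ^ n)
  - (Num.sqrt b%:R - 1) * \sum_(1 <= k < n.+1) block_term b a k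
  - block_term b a n.

Section Inequality.
Variables (R : realType) (b : nat) (hb : (1 < b)%N) (a : nat -> R[i]).
Let r : R := Num.sqrt b%:R.
Notation x := (block_term b a).

Lemma sqr_sqrt_base : Num.sqrt b%:R ^+ 2 = b%:R :> R.
Proof. by rewrite sqr_sqrtr. Qed.

Lemma sqrt_base_gt1 : 1 < Num.sqrt b%:R :> R.
Proof. by rewrite -[X in X < _]sqrtr1 ltr_sqrt ?ltr1n // ltr0n; lia. Qed.

Lemma energy_ge0 n : 0 <= energy a n.
Proof. by apply: sumr_ge0 => j _; apply: sqr_ge0. Qed.

Lemma block_term_ge0 k : 0 <= x k.
Proof. by rewrite mulr_ge0 ?sqr_ge0 // invr_ge0 exprn_ge0. Qed.

Lemma energy_split m n : (m <= n)%N ->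
  energy a n = energy a m + \sum_(m.+1 <= j < n.+1) normc (a j) ^+ 2.
Proof. by move=> mn; rewrite /energy -big_cat_nat. Qed.

Lemma energy_homo m n : (m <= n)%N -> energy a m <= energy a n.
Proof.
move=> mn; rewrite (energy_split mn) lerDl.
by apply: sumr_ge0 => j _; apply: sqr_ge0.
Qed.

Lemma gapS n :
  gap b a n.+1 = gap b a n +
    ((r + 1) * (energy a (b ^ n.+1) - energy a (b ^ n)) + x n - r * x n.+1).
Proof. by rewrite /gap -/r (big_nat_recr n.+1) //=; ring. Qed.

(** Both facts concern the splitting of the sum up to b^(n+1) at b^n; they are
    kept apart because the strict case uses them without the weighted
    inequality. *)
Lemma block_bound n (u := normc (\sum_(1 <= j < (b ^ n).+1) a j))
    (t := normc (\sum_((b ^ n).+1 <= j < (b ^ n.+1).+1) a j)) :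
  r * x n.+1 * (r * b%:R ^+ n) <= (u + t) ^+ 2 /\
  t ^+ 2 <= b%:R ^+ n * (r ^+ 2 - 1) * (energy a (b ^ n.+1) - energy a (b ^ n)).
Proof.
have bb : (b ^ n <= b ^ n.+1)%N by rewrite leq_exp2l.
split.
  have b0 : b%:R ^+ n.+1 != 0 :> R by rewrite expf_neq0 // pnatr_eq0; lia.
  rewrite /block_term (_ : _ * _ = r ^+ 2 * b%:R ^+ n * (b%:R ^+ n.+1)^-1 *
     normc (\sum_(1 <= j < (b ^ n.+1).+1) a j) ^+ 2); last by ring.
  rewrite sqr_sqrt_base -exprS mulfV // mul1r.
  rewrite lerXn2r ?nnegrE ?addr_ge0 ?normc_ge0 //.
  by rewrite (@big_cat_nat _ _ _ (b ^ n).+1) //= le_normcD.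
rewrite sqr_sqrt_base.
have -> : energy a (b ^ n.+1) - energy a (b ^ n) =
    \sum_((b ^ n).+1 <= j < (b ^ n.+1).+1) normc (a j) ^+ 2.
  by rewrite (energy_split bb) addrAC subrr add0r.
have := sqr_normc_sum_le a (b ^ n).+1 (b ^ n.+1).+1.
rewrite subSS (_ : _%:R = b%:R ^+ n * (b%:R - 1)) //.
by rewrite natrB // !natrX exprS; ring.
Qed.

(** The estimate r x_(n+1) <= x_n + (r + 1) (E(b^(n+1)) - E(b^n)), multiplied by
    the positive number (r - 1) r b^n to clear denominators. *)
Lemma gap_homo n : gap b a n <= gap b a n.+1.
Proof.
rewrite gapS lerDl subr_ge0; have [] := block_bound n.
set u := normc _; set t := normc _; set e := _ - energy _ _.
have r1 : 1 < r := sqrt_base_gt1.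
set B : R := b%:R ^+ n => h1 h2.
have B0 : 0 < B by rewrite exprn_gt0 // ltr0n; lia.
have xn : u ^+ 2 = B * x n.
  by rewrite /block_term -/B -/u mulrA divff ?mul1r // gt_eqF.
have h3 := weighted_sqrD_le u t r1.
have r0 : 0 < r - 1 by rewrite subr_gt0.
have rB : 0 < (r - 1) * (r * B) by rewrite !mulr_gt0 //; lra.
rewrite -(ler_pM2l rB) -mulrA [_ * (r * x _)]mulrC.
apply: (le_trans (_ : _ <= (r - 1) * (u + t) ^+ 2)); first by rewrite ler_pM2l.
apply: (le_trans h3); rewrite xn.
have /ler_wpM2l : 0 <= r by lra.
move=> /(_ _ _ h2); lra.
Qed.

Lemma gap0 : gap b a 0 = r * energy a 1.
Proof.
rewrite /gap /block_term expn0 expr0 invr1 mul1r /energy.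
rewrite [X in _ - _ * X - _]big_geq // !big_nat1 -/r.
by ring.
Qed.

Lemma gap_ge0 n : 0 <= gap b a n.
Proof.
elim: n => [|n IH]; last exact: le_trans IH (gap_homo n).
by rewrite gap0 mulr_ge0 ?sqrtr_ge0 ?energy_ge0.
Qed.

(** At the first block with a nonzero term the preceding partial sum vanishes,
    so Cauchy-Schwarz alone gives r x_(n+1) <= (r^2 - 1) / r e, which is less
    than the (r + 1) e allowed by the one-step estimate. *)
Lemma gap_gt0 n : 0 < energy a (b ^ n) -> 0 < gap b a n.
Proof.
elim: n => [|n IH] en; first by rewrite gap0 mulr_gt0 // sqrtr_gt0 ltr0n; lia.
have := energy_ge0 (b ^ n).
rewrite le_eqVlt => /predU1P[e0|/IH/lt_le_trans]; last first.
  by apply; apply: gap_homo.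
have r1 : 1 < r := sqrt_base_gt1.
have g0 := gap_ge0 n.
have X0 : 0 <= \sum_(1 <= k < n.+1) x k.
  by apply: sumr_ge0 => k _; apply: block_term_ge0.
(* E(b^n) = 0 turns gap n >= 0 into an upper bound for x n. *)
have xn0 : x n = 0.
  apply: le_anti; rewrite block_term_ge0 andbT.
  move: g0; rewrite /gap -/r -e0 mulr0; nra.
apply: (le_lt_trans g0); rewrite gapS ltrDl subr_gt0 xn0 addr0 -e0 subr0.
have [] := block_bound n.
set u := normc _; set t := normc _; rewrite -e0 subr0.
set e := energy _ _ in en *; set B : R := b%:R ^+ n => h1 h2.
have B0 : 0 < B by rewrite exprn_gt0 // ltr0n; lia.
have u0 : u = 0.
  have /eqP : B^-1 * u ^+ 2 = 0 := xn0.
  by rewrite mulf_eq0 invr_eq0 gt_eqF //= sqrf_eq0 => /eqP.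
move: h1; rewrite u0 add0r => /le_trans/(_ h2).
rewrite (_ : _ * (r ^+ 2 - 1) * e = (r ^+ 2 - 1) * e * B); last by ring.
rewrite mulrA ler_pM2r // => h.
have r0 : 0 < r by lra.
rewrite -(ltr_pM2r r0); nra.
Qed.

Lemma sum_block_term_le n :
  (r - 1) * \sum_(1 <= k < n.+1) x k <= (r + 1) * energy a (b ^ n).
Proof. by have := gap_ge0 n; have := block_term_ge0 n; rewrite /gap -/r; lra. Qed.

End Inequality.

(** * Passage to infinite series *)

Section Series.
Variables (R : realType) (b : nat) (hb : (1 < b)%N).
Implicit Types (a : nat -> R[i]) (u : nat -> R).
Let r : R := Num.sqrt b%:R.

Lemma nneseries_le u (M : \bar R) : (forall n, 0 <= u n) ->
  (forall n, ((\sum_(1 <= k < n.+1) u k)%:E <= M)%E) ->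
  (\sum_(1 <= k <oo) (u k)%:E <= M)%E.
Proof.
move=> u0 uM; apply: lime_le.
  by apply: is_cvg_nneseries => n _ _; rewrite lee_fin.
apply: nearW => -[|n]; rewrite sumEFin; last exact: uM.
by have := uM 0%N; rewrite !big_geq.
Qed.

Lemma partial_sum_le_nneseries u n : (forall n, 0 <= u n) ->
  ((\sum_(1 <= k < n.+1) u k)%:E <= \sum_(1 <= k <oo) (u k)%:E)%E.
Proof.
by move=> u0; rewrite -sumEFin; apply: nneseries_lim_ge => k _ _; rewrite lee_fin.
Qed.

Lemma energy_le_sum_sq a n : ((energy a n)%:E <= sum_sq a)%E.
Proof. by apply: partial_sum_le_nneseries => k; apply: sqr_ge0. Qed.

Lemma leq_base_exp n : (n <= b ^ n)%N.
Proof. exact/ltnW/ltn_expl. Qed.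

(** The ranks b^n suffice because they are cofinal and the energy increases. *)
Lemma sum_sq_le a (M : \bar R) :
  (forall n, ((energy a (b ^ n))%:E <= M)%E) -> (sum_sq a <= M)%E.
Proof.
move=> h; apply: nneseries_le => [k|n]; first exact: sqr_ge0.
by apply: le_trans (h n); rewrite lee_fin; apply: energy_homo; apply: leq_base_exp.
Qed.

Lemma block_normE a :
  block_norm b a = sqrte (\sum_(1 <= k <oo) (block_term b a k)%:E)%E.
Proof.
apply: poweR12_sqrt.
by apply: nneseries_ge0 => n _ _; rewrite lee_fin block_term_ge0.
Qed.

Lemma sum_sq_ge0 a : (0 <= sum_sq a)%E.
Proof. by apply: nneseries_ge0 => n _ _; rewrite lee_fin sqr_ge0. Qed.

Lemma scaled_l2normE a (C : R) : 0 <= C ->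
  (C%:E * l2norm a)%E = sqrte ((C ^+ 2)%:E * sum_sq a)%E.
Proof.
move=> C0; rewrite /l2norm poweR12_sqrt ?sum_sq_ge0 //.
by rewrite sqrteM ?lee_fin ?sqr_ge0 //= sqrtr_sqr ger0_norm.
Qed.

Lemma block_norm_le_sqr a (C : R) : 0 <= C ->
  (block_norm b a <= C%:E * l2norm a)%E =
  (\sum_(1 <= k <oo) (block_term b a k)%:E <= (C ^+ 2)%:E * sum_sq a)%E.
Proof.
move=> C0; rewrite block_normE scaled_l2normE // lee_sqrt //.
by rewrite mule_ge0 ?sum_sq_ge0 // lee_fin sqr_ge0.
Qed.

Lemma block_norm_lt_sqr a (C : R) : 0 <= C ->
  (block_norm b a < C%:E * l2norm a)%E =
  (\sum_(1 <= k <oo) (block_term b a k)%:E < (C ^+ 2)%:E * sum_sq a)%E.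
Proof.
move=> C0; rewrite block_normE scaled_l2normE // !ltNge lee_sqrt //.
by apply: nneseries_ge0 => n _ _; rewrite lee_fin block_term_ge0.
Qed.

Lemma sharp_const_gt0 : 0 < sharp_const R b.
Proof.
have := sqrt_base_gt1 R hb => r1.
by rewrite divr_gt0 ?sqrtr_gt0 ?subr_gt0 ?ltr1n //; lra.
Qed.

Lemma sqr_sharp_const : sharp_const R b ^+ 2 = (r + 1) / (r - 1).
Proof.
have r1 : 1 < r := sqrt_base_gt1 R hb.
rewrite /sharp_const expr_div_n sqr_sqrtr ?subr_ge0 ?ler1n; last by lia.
rewrite -/r -(sqr_sqrt_base R b) -/r; field.
by apply/andP; split; rewrite gt_eqF //; nra.
Qed.

Lemma block_series_le a :
  (\sum_(1 <= k <oo) (block_term b a k)%:E <=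
   (sharp_const R b ^+ 2)%:E * sum_sq a)%E.
Proof.
have r1 : 1 < r := sqrt_base_gt1 R hb.
have rm : 0 < r - 1 by lra.
apply: nneseries_le => [k|n]; first exact: block_term_ge0.
apply: (@le_trans _ _ ((sharp_const R b ^+ 2)%:E * (energy a (b ^ n))%:E)%E).
  rewrite lee_fin sqr_sharp_const mulrAC ler_pdivlMr // mulrC.
  exact: sum_block_term_le.
by apply: lee_wpmul2l; [rewrite lee_fin sqr_ge0 | apply: energy_le_sum_sq].
Qed.

Lemma gap_le a m n : (m <= n)%N -> gap b a m <= gap b a n.
Proof.
by move/subnKC => <-; elim: (n - m)%N => [|k IH];
  rewrite ?addn0 // addnS (le_trans IH) // gap_homo.
Qed.

(** The gap at any fixed rank m survives in the limit, since gap N >= gap m for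
    all N >= m. *)
Lemma block_series_gap a (A : R) m : sum_sq a = A%:E ->
  (\sum_(1 <= k <oo) (block_term b a k)%:E <=
   (sharp_const R b ^+ 2 * A - gap b a m / (r - 1))%:E)%E.
Proof.
move=> aA; have r1 : 1 < r := sqrt_base_gt1 R hb.
have rm : 0 < r - 1 by lra.
apply: nneseries_le => [k|n]; first exact: block_term_ge0.
pose N := maxn m n; have mN : (m <= N)%N := leq_maxl _ _.
have nN : (n.+1 <= N.+1)%N by rewrite ltnS leq_maxr.
apply: (@le_trans _ _ (\sum_(1 <= k < N.+1) block_term b a k)%:E).
  rewrite lee_fin (@big_cat_nat _ _ _ n.+1 1 N.+1) //= lerDl.
  by apply: sumr_ge0 => k _; apply: block_term_ge0.
have := energy_le_sum_sq a (b ^ N); rewrite aA !lee_fin => EA.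
rewrite sqr_sharp_const mulrAC -mulrBl ler_pdivlMr //.
have := gap_le a mN; have := block_term_ge0 b a N; rewrite {2}/gap -/r.
have : (r + 1) * energy a (b ^ N) <= (r + 1) * A by rewrite ler_pM2l //; lra.
lra.
Qed.

Lemma block_series_lt a : in_l2 a -> (exists2 n, (1 <= n)%N & a n != 0) ->
  (\sum_(1 <= k <oo) (block_term b a k)%:E <
   (sharp_const R b ^+ 2)%:E * sum_sq a)%E.
Proof.
move=> al2 [n n1 an0].
have /fineK/esym aA : sum_sq a \is a fin_num.
  by rewrite ge0_fin_numE ?sum_sq_ge0.
apply: (le_lt_trans (block_series_gap n aA)).
rewrite aA -EFinM lte_fin gtrBl; apply: divr_gt0; last first.
  by rewrite subr_gt0 sqrt_base_gt1.
apply: gap_gt0 => //.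
apply: (lt_le_trans _ (energy_homo a (leq_base_exp n))).
case: n n1 an0 => // n _ an0.
rewrite /energy big_nat_recr //= ltr_wpDl ?exprn_gt0 ?normc_gt0 //.
exact: energy_ge0.
Qed.

End Series.

(** * Sharpness of the constant *)

Section Sharpness.
Variables (R : realType) (b : nat) (hb : (1 < b)%N).
Let r : R := Num.sqrt b%:R.

(** On the block b^k < n <= b^(k+1) the value is the constant
    (r^(k+1) - r^k) / (b^(k+1) - b^k), simplified by b = r^2, that takes the
    partial sums from r^k to r^(k+1). The predecessor in the logarithm puts
    b^(k+1) in the block it closes. *)
Definition extremal (N n : nat) : R :=
  if (n <= 1)%N then 1 else
  let k := trunc_log b n.-1 in
  if (k < N)%N then (r ^+ k * (r + 1))^-1 else 0.

Lemma extremal_block N k j : (b ^ k < j <= b ^ k.+1)%N ->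
  extremal N j = if (k < N)%N then (r ^+ k * (r + 1))^-1 else 0.
Proof.
case/andP=> kj jk; rewrite /extremal.
have bk : (0 < b ^ k)%N by rewrite expn_gt0; lia.
have -> : trunc_log b j.-1 = k by apply: trunc_log_eq => //; lia.
by rewrite leqNgt (leq_ltn_trans bk kj).
Qed.

(** Stated for a general f so as to serve both the partial sums and the
    energy. *)
Lemma sum_extremal_block (f : R -> R) N k :
  \sum_((b ^ k).+1 <= j < (b ^ k.+1).+1) f (extremal N j) =
  r ^+ k ^+ 2 * (r ^+ 2 - 1) *
  f (if (k < N)%N then (r ^+ k * (r + 1))^-1 else 0).
Proof.
set v := f (if _ then _ else _).
rewrite (@eq_big_nat _ _ _ _ _ _ (fun=> v)); last first.
  by move=> j kj; rewrite (extremal_block _ (k := k)) //; lia.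
rewrite sumr_const_nat subSS -mulr_natl natrB ?leq_exp2l // !natrX.
by congr (_ * _); rewrite -(sqr_sqrt_base R b) -/r exprS exprAC; ring.
Qed.

Lemma sum_extremal N k : (k <= N)%N ->
  \sum_(1 <= j < (b ^ k).+1) extremal N j = r ^+ k.
Proof.
have r1 : 1 < r := sqrt_base_gt1 R hb.
elim: k => [|k IH] kN; first by rewrite expn0 big_nat1.
rewrite (@big_cat_nat _ _ _ (b ^ k).+1) //= ?ltnS ?leq_exp2l // IH 1?ltnW //.
rewrite (sum_extremal_block id) kN [RHS]exprS /=.
have rk : 0 < r ^+ k by rewrite exprn_gt0 //; lra.
move: (r ^+ k) rk => q q0.
by field; rewrite !gt_eqF //=; lra.
Qed.

Lemma energy_extremal N m :
  energy (fun n => (extremal N n)%:C) (b ^ m) =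
  1 + (minn m N)%:R * ((r - 1) / (r + 1)).
Proof.
have r1 : 1 < r := sqrt_base_gt1 R hb.
elim: m => [|m IH].
  by rewrite /energy expn0 big_nat1 normc_real /= normr1 expr1n min0n mul0r addr0.
rewrite (@energy_split _ _ (b ^ m)) ?leq_exp2l // IH.
under eq_bigr => j _ do rewrite normc_real real_normK ?num_real //.
rewrite (sum_extremal_block (fun x => x ^+ 2)).
have [mN|Nm] := ltnP m N; last first.
  by rewrite expr0n mulr0 addr0 (minn_idPr (leqW Nm)).
rewrite (minn_idPl mN) -addrA; congr (_ + _).
have rk : 0 < r ^+ m by rewrite exprn_gt0 //; lra.
by rewrite -natr1; field; rewrite !gt_eqF //=; lra.
Qed.

Lemma block_term_extremal N k : (k <= N)%N ->
  block_term b (fun n => (extremal N n)%:C) k = 1.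
Proof.
move=> kN; rewrite /block_term -(rmorph_sum (real_complex R)).
rewrite normc_real.
rewrite sum_extremal // real_normK ?num_real // -(sqr_sqrt_base R b) -/r.
rewrite exprAC mulVf // sqrf_eq0 expf_neq0 // gt_eqF //.
by have := sqrt_base_gt1 R hb; rewrite -/r; lra.
Qed.

(** Testing on the extremal sequences gives N <= C^2 (1 + N / K^2) for all N,
    with K the sharp constant; dividing by N, this needs C >= K. *)
Lemma constant_ge (C : R) : 0 <= C ->
  (forall a : nat -> R[i], (block_norm b a <= C%:E * l2norm a)%E) ->
  sharp_const R b <= C.
Proof.
move=> C0 hC.
have r1 : 1 < r := sqrt_base_gt1 R hb.
have bound (N : nat) : N%:R <= C ^+ 2 * (1 + N%:R * ((r - 1) / (r + 1))).
  have := hC (fun n => (extremal N n)%:C); rewrite block_norm_le_sqr // => h.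
  rewrite -lee_fin EFinM.
  apply: le_trans (le_trans h _); last first.
    apply: lee_wpmul2l; first by rewrite lee_fin sqr_ge0.
    apply: (sum_sq_le hb) => m; rewrite energy_extremal lee_fin lerD2l.
    by rewrite ler_wpM2r ?ler_nat ?geq_minr // divr_ge0 //; lra.
  apply: le_trans (partial_sum_le_nneseries N (block_term_ge0 b _)).
  rewrite lee_fin (@eq_big_nat _ _ _ _ _ _ (fun=> 1)).
    by rewrite sumr_const_nat subSS subn0.
  by move=> k kN; rewrite block_term_extremal //; lia.
rewrite leNgt; apply/negP => CK.
have {}CK : C ^+ 2 * ((r - 1) / (r + 1)) < 1.
  have : C ^+ 2 < sharp_const R b ^+ 2.
    by rewrite ltrXn2r // nnegrE ltW // sharp_const_gt0.
  rewrite sqr_sharp_const // -/r ltr_pdivlMr; last lra.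
  by move=> h; rewrite mulrA ltr_pdivrMr ?mul1r //; lra.
set d := C ^+ 2 * _ in CK.
have d0 : 0 < 1 - d by rewrite subr_gt0.
have : 0 <= C ^+ 2 / (1 - d) by rewrite divr_ge0 ?sqr_ge0 // ltW.
move/archi_boundP; set N := Num.Def.archi_bound _; rewrite ltr_pdivrMr //.
have := bound N; rewrite mulrDr mulr1 mulrCA -/d; lra.
Qed.

End Sharpness.

Theorem theorem2 (R : realType) (b : nat) (hb : (1 < b)%N) :
  [/\ (forall a : nat -> R[i],
         (block_norm b a <= (sharp_const R b)%:E * l2norm a)%E),
      (forall C : R, C < sharp_const R b ->
         ~ (forall a : nat -> R[i], (block_norm b a <= C%:E * l2norm a)%E))
    & (forall a : nat -> R[i], in_l2 a ->
         ~ (forall n : nat, (1 <= n)%N -> a n = 0) ->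
         (block_norm b a < (sharp_const R b)%:E * l2norm a)%E)].
Proof.
have K0 := sharp_const_gt0 R hb; split.
- by move=> a; rewrite block_norm_le_sqr ?(ltW K0) // block_series_le.
- move=> C CK hC.
  (* A negative C is also excluded: the bound would then hold with 0 for C. *)
  have : sharp_const R b <= Num.max C 0.
    apply: constant_ge; rewrite ?le_max ?lexx ?orbT // => a.
    apply: le_trans (hC a) _; apply: lee_wpmul2r; first exact: poweR_ge0.
    by rewrite lee_fin le_max lexx.
  by rewrite le_max !leNgt CK K0.
- move=> a al2 a0.
  have {a0} [n n1 an0] : exists2 n, (1 <= n)%N & a n != 0.
    apply: contra_notP a0 => h n n1; apply/eqP/negP => /negP an0.
    by apply: h; exists n.
  by rewrite block_norm_lt_sqr ?(ltW K0) // block_series_lt //; exists n.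
Qed.
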